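(* Let $g,h:(0,1)\to\mathbb{R}$ be bounded (measurable) functions with $g\ge0$ and $$\lim_{t\to1-}\frac1{1-t}\int_t^1g(s)\,ds=0,\qquad \lim_{t\to1-}\frac1{1-t}\int_t^1h(s)\,ds=0 .$$ Then there exist a positive monotone function $\lambda(t)$ on $(0,1)$ with $\lim_{t\to1-}\lambda(t)=\infty$ and a sequence of times $\tilde t_k\in(0,1)$ with $\tilde t_k\to1$ as $k\to\infty$ such that $$\limsup_{k\to\infty}\ \sup_{\tau\in(0,1-\tilde t_k)}\frac1\tau\int_{\tilde t_k}^{\tilde t_k+\tau}\big(\lambda(s)g(s)+h(s)\big)\,ds\le0 .$$ *)

(* Defs.v *)
From HB Require Import structures.
From mathcomp Require Import all_boot all_order all_algebra.
From mathcomp Require Import all_classical all_reals all_analysis.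

Set Implicit Arguments.
Unset Strict Implicit.
Unset Printing Implicit Defensive.

Import Order.TTheory GRing.Theory Num.Theory.
Import numFieldNormedType.Exports.

Local Open Scope classical_set_scope.
Local Open Scope ring_scope.

(* The canonical measurable sets of [R] are the Borel sets; on this copy of [R]
   they are the Lebesgue-measurable (i.e. Caratheodory) sets, which is the
   sigma-algebra on which [completed_lebesgue_measure] lives. *)
Notation lebesgueType R :=
  (caratheodory_type ((wlength (@idfun R))^*)%mu).

Definition lebesgue_measurable_fun (R : realType) (D : set R) (f : R -> R) :=
  measurable_fun (D : set (lebesgueType R)) (f : lebesgueType R -> R).

Definition lebesgue_Rintegral (R : realType) (D : set R) (f : R -> R) : R :=
  \int[@completed_lebesgue_measure R]_(s in D) f s.

(* Main.v *)
Require Import Defs.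
From HB Require Import structures.
From mathcomp Require Import all_boot all_order all_algebra.
From mathcomp Require Import all_classical all_reals all_analysis.
From mathcomp Require Import lra.

Set Implicit Arguments.
Unset Strict Implicit.
Unset Printing Implicit Defensive.

Import Order.TTheory GRing.Theory Num.Theory.
Import numFieldNormedType.Exports.

Local Open Scope classical_set_scope.
Local Open Scope ring_scope.

(** Two independent ideas are combined.

    A weight that grows slowly enough.  Choose thresholds T n < 1 such that
    the integral of g over ]t, 1[ is at most d_n (1 - t) whenever T n <= t,
    where d_n = 1/(n+1) - 1/(n+2).  The weight lambda counts the thresholds
    already passed: it is 1 plus the number of n below 1/(1-s) with
    T n <= s, the cut-off at 1/(1-s) serving only to keep the count finite.
    Integrated over [a, b], the n-th threshold contributes at most the integral
    of g over ]max(a, T n), 1[, hence at most d_n (1 - a).  The terms n >= m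
    together contribute at most (1 - a)/(m+1), since the d_n telescope; the
    constant 1 and the first m terms contribute at most m + 1 times the integral
    of g over ]a, 1[, which is o(1 - a) for fixed m.  So, with f = lambda g + h, the integral of f over
    [a, b] is at most a small multiple of 1 - a, uniformly in b in [a, 1[
    ([lebesgue_Rintegral_slow_weight_le]).

    Good starting times.  Let c be the midpoint of a and 1, and let t minimize
    P s = e s - (integral of f over [a, s]) on [a, c].  The inequality
    P t <= P (t + tau) says exactly that the average of f over [t, t + tau] is
    at most e.  It holds for t + tau <= c by the choice of t.  For t + tau > c,
    the uniform bound above makes the integral in P (t + tau) at most
    e (c - a), so that P (t + tau) >= e a = P a >= P t
    ([exists_forward_average_le]).  Working on [a, c] avoids any question of
    integrability of f up to 1.

    Taking e = 1/(k+1) and a close enough to 1 gives the times t_k. *)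

(** * Integrals over intervals for the completed Lebesgue measure *)

Section lebesgue_intervals.
Context {R : realType}.
Implicit Types (f g : R -> R) (D : set R) (a b c s t x y : R).

Local Notation mu := (@completed_lebesgue_measure R).

Definition lebesgue_integrable D f :=
  mu.-integrable (D : set (lebesgueType R)) (EFin \o f).

Lemma lebesgue_measurable_interval D :
  is_interval D -> measurable (D : set (lebesgueType R)).
Proof.
move=> iD; apply: sub_caratheodory.
exact: (measurable_realfun.is_interval_measurable iD).
Qed.

Lemma lebesgue_measurable_itv (i : interval R) :
  measurable ([set` i] : set (lebesgueType R)).
Proof. by apply: lebesgue_measurable_interval; exact: interval_is_interval. Qed.

(** The superlevel sets of a monotone function on an interval are intervals. *)
Lemma lebesgue_measurable_monotone D f : is_interval D ->
  {in D &, {homo f : x y / x <= y}} -> lebesgue_measurable_fun D f.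
Proof.
move=> iD ndf mD.
apply: (measurability _ (measurable_realfun.RGenOInfty.measurableE R)) => //.
move=> _ [_ [r ->] <-]; apply: lebesgue_measurable_interval.
move=> x y [/= Dx fx] [Dy _] z /[dup] xzy /andP[xz zy].
have Dz : D z by apply: (iD x y).
split=> //=; move: fx; rewrite !in_itv/= !andbT => /lt_le_trans; apply.
by apply: ndf; rewrite ?inE.
Qed.

Lemma lebesgue_measure_itvcc x y : x <= y ->
  mu [set` `[x, y]] = (y - x)%:E.
Proof.
move=> xy; rewrite -[LHS]/(lebesgue_measure _) lebesgue_measure_itv/=.
by rewrite lte_fin; case: ltgtP xy => // ->; rewrite subrr.
Qed.

Lemma lebesgue_measure_itv_lty (b b' : bool) x y :
  (mu [set` Interval (BSide b x) (BSide b' y)] < +oo)%E.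
Proof.
rewrite -[X in (X < _)%E]/(lebesgue_measure _) lebesgue_measure_itv/=.
by case: ifP => _; rewrite ltry.
Qed.

Lemma lebesgue_bounded_integrable (D : interval R) f M :
  lebesgue_measurable_fun [set` D] f -> (mu [set` D] < +oo)%E ->
  (forall x, x \in D -> `|f x| <= M) -> lebesgue_integrable [set` D] f.
Proof.
move=> mf Dfin fM; apply: measurable_bounded_integrable => //.
  exact: lebesgue_measurable_itv.
exists M; split; first exact: num_real.
by move=> z /ltW Mz x /= /fM /le_trans; apply.
Qed.

Lemma lebesgue_integrableS D (i : interval R) f : [set` i] `<=` D ->
  measurable (D : set (lebesgueType R)) ->
  lebesgue_integrable D f -> lebesgue_integrable [set` i] f.
Proof.
by move=> ? ?; apply: integrableS => //; exact: lebesgue_measurable_itv.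
Qed.

Lemma lebesgue_Rintegral_cat (p q r : itv_bound R) f :
  (p <= q)%O -> (q <= r)%O -> lebesgue_integrable [set` Interval p r] f ->
  lebesgue_Rintegral [set` Interval p r] f =
  lebesgue_Rintegral [set` Interval p q] f +
  lebesgue_Rintegral [set` Interval q r] f.
Proof.
move=> pq qr intf; rewrite /lebesgue_Rintegral.
rewrite (itv_bndbnd_setU pq qr) Rintegral_setU//.
- exact: lebesgue_measurable_itv.
- exact: lebesgue_measurable_itv.
- by rewrite -(itv_bndbnd_setU pq qr).
apply/disj_setPS => y [/=]; rewrite !itv_boundlr => /andP[_ yq] /andP[qy _].
by have := le_trans yq qy; rewrite bnd_simp ltxx.
Qed.

Lemma lebesgue_Rintegral_set1 x f : lebesgue_Rintegral `[x, x] f = 0.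
Proof.
apply: (congr1 fine (_ : _ = 0%:E)); apply: null_set_integral.
- exact: lebesgue_measurable_itv.
- by rewrite set_itv1; exact: measurable_fun_set1.
- by have := lebesgue_measure_itvcc (lexx x); rewrite subrr.
Qed.

End lebesgue_intervals.

(** * Starting points with small forward averages *)

Section forward_minimum.
Context {R : realType}.
Implicit Types (f : R -> R) (a b c e s t x y M : R).

Lemma lebesgue_Rintegral_chasles a x y f : a <= x -> x <= y ->
  lebesgue_integrable `[a, y] f ->
  lebesgue_Rintegral `[a, y] f =
  lebesgue_Rintegral `[a, x] f + lebesgue_Rintegral `]x, y] f.
Proof. by move=> ax xy; exact: lebesgue_Rintegral_cat. Qed.

Lemma lebesgue_Rintegral_oc_cc x y f : x <= y ->
  lebesgue_integrable `[x, y] f ->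
  lebesgue_Rintegral `]x, y] f = lebesgue_Rintegral `[x, y] f.
Proof.
move=> xy intf; rewrite (lebesgue_Rintegral_chasles (lexx x) xy intf).
by rewrite lebesgue_Rintegral_set1 add0r.
Qed.

Lemma normr_lebesgue_Rintegral_le x y f M : x <= y ->
  lebesgue_integrable `[x, y] f -> (forall s, s \in `[x, y] -> `|f s| <= M) ->
  `|lebesgue_Rintegral `[x, y] f| <= M * (y - x).
Proof.
move=> xy intf fM; have mD := @lebesgue_measurable_itv R `[x, y].
have dxy := lebesgue_measure_itvcc xy.
apply: le_trans (le_normr_Rintegral mD intf) _.
have -> : M * (y - x) =
    \int[@completed_lebesgue_measure R]_(_ in `[x, y]) M.
  by rewrite Rintegral_cst//; congr (_ * _); exact: (congr1 fine (esym dxy)).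
apply: le_Rintegral => //.
- exact: integrable_norm.
- apply: (@lebesgue_bounded_integrable _ _ _ `|M|) => //.
    exact: measurable_cst.
  exact: lebesgue_measure_itv_lty.
Qed.

(** The bound on f makes its primitive Lipschitz. *)
Lemma lebesgue_primitive_continuous a c f M : a <= c ->
  lebesgue_integrable `[a, c] f -> (forall s, s \in `[a, c] -> `|f s| <= M) ->
  {within `[a, c], continuous (fun s => lebesgue_Rintegral `[a, s] f)}.
Proof.
move=> ac intf fM.
have lip x y : a <= x -> x <= y -> y <= c ->
    `|lebesgue_Rintegral `[a, x] f - lebesgue_Rintegral `[a, y] f|
      <= M * (y - x).
  move=> ax xy yc; rewrite (lebesgue_Rintegral_chasles ax xy); last first.
    apply: lebesgue_integrableS intf; last exact: lebesgue_measurable_itv.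
    by apply: subset_itvScc; rewrite ?bnd_simp.
  have sub : `[x, y] `<=` `[a, c] by apply: subset_itvScc; rewrite ?bnd_simp.
  have intxy : lebesgue_integrable `[x, y] f.
    by apply: lebesgue_integrableS intf => //; exact: lebesgue_measurable_itv.
  rewrite lebesgue_Rintegral_oc_cc// opprD addNKr normrN.
  by apply: normr_lebesgue_Rintegral_le => // s /sub /fM.
have M0 : 0 <= M.
  by apply: le_trans (fM a _) => //; rewrite in_itv/= lexx.
have lip2 x y : x \in `[a, c] -> y \in `[a, c] ->
    `|lebesgue_Rintegral `[a, x] f - lebesgue_Rintegral `[a, y] f|
      <= M * `|x - y|.
  rewrite !in_itv/= => /andP[ax xc] /andP[ay yc].
  have [xy|/ltW yx] := leP x y.
    by rewrite [in leRHS]ler0_norm ?subr_le0// opprB; exact: lip.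
  by rewrite distrC [in leRHS]ger0_norm ?subr_ge0//; exact: lip.
apply/subspace_continuousP => x /= xac; apply/cvgrPdist_le => /= e e0.
have nx : \forall z \near x, `|x - z| <= e / (M + 1).
  by apply: (@cvgr_dist_le _ _ _ (nbhs x) _ id x) => //;
    rewrite divr_gt0// ltr_wpDl.
rewrite near_withinE; apply: filterS nx => y xy yac.
apply: le_trans (lip2 _ _ xac yac) _.
apply: (@le_trans _ _ (M * (e / (M + 1)))); first exact: ler_wpM2l.
rewrite mulrCA ler_piMr ?(ltW e0)// ler_pdivrMr ?mul1r ?lerDl//.
by rewrite ltr_wpDl.
Qed.

(** A variant of the rising sun lemma: a minimizer t of
    e s - (integral of f over [a, s]) on [a, c] works.  Beyond c minimality is
    replaced by the bound on the integral of f over [a, b], which puts the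
    functional above its value at a. *)
Lemma exists_forward_average_le a c d e f M : a < c -> c < d -> 0 <= e ->
  (forall b, b < d -> lebesgue_integrable `[a, b] f) ->
  (forall s, s \in `[a, c] -> `|f s| <= M) ->
  (forall b, b \in `]c, d[ -> lebesgue_Rintegral `[a, b] f <= e * (c - a)) ->
  exists2 t, t \in `[a, c] & forall tau, tau \in `]0, d - t[ ->
    lebesgue_Rintegral `[t, t + tau] f <= e * tau.
Proof.
move=> ac cd e0 intf fM fc.
pose P s := e * s - lebesgue_Rintegral `[a, s] f.
have [||t tac tmin] := @EVT_min _ P a c; first exact: ltW.
  move=> x; apply: continuousB.
    apply: continuous_subspaceT => y; apply: continuousM => //.
    exact: cst_continuous.
  by apply: lebesgue_primitive_continuous fM _; rewrite ?(ltW ac)//; exact: intf.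
exists t => // tau; rewrite in_itv/= => /andP[tau0 taud].
move: (tac); rewrite in_itv/= => /andP[at_ tc].
have Pt : P t <= P (t + tau).
  have [tauc|ctau] := leP (t + tau) c.
    by apply: tmin; rewrite in_itv/= tauc andbT; lra.
  (* past c, the value at a serves as an intermediate bound *)
  apply: le_trans (tmin a _) _; first by rewrite in_itv/= lexx ltW.
  rewrite /P lebesgue_Rintegral_set1 subr0.
  have /fc : t + tau \in `]c, d[ by rewrite in_itv/= ctau; lra.
  have : e * (c - a) <= e * (t + tau - a) by rewrite ler_wpM2l//; lra.
  by lra.
have ttau : t <= t + tau by lra.
have int1 : lebesgue_integrable `[a, t + tau] f by apply: intf; lra.
move: Pt; rewrite /P (lebesgue_Rintegral_chasles at_ ttau int1).
rewrite lebesgue_Rintegral_oc_cc//; last first.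
  apply: lebesgue_integrableS int1; last exact: lebesgue_measurable_itv.
  by apply: subset_itvScc; rewrite ?bnd_simp.
by lra.
Qed.

End forward_minimum.

(** * A counting weight *)

Section slow_weight.
Context {R : realType}.
Implicit Types (g h : R -> R) (T : nat -> R) (a b e s t x y : R) (m n : nat).

(** Meant for s < 1.  The sum is cut off at 1/(1-s), which tends to infinity as
    s tends to 1, so that it is finite without any condition on how the
    thresholds T n accumulate. *)
Definition slow_weight T s : R :=
  1 + \sum_(0 <= n < Num.truncn (1 - s)^-1) (T n <= s)%R%:R.

Lemma slow_weight_ge1 T s : 1 <= slow_weight T s.
Proof. by rewrite /slow_weight lerDl sumr_ge0. Qed.

Lemma slow_weight_gt0 T s : 0 < slow_weight T s.
Proof. exact: lt_le_trans (slow_weight_ge1 T s). Qed.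

Lemma le_truncn_inv_dist1 s t : s <= t -> t < 1 ->
  (Num.truncn (1 - s)^-1 <= Num.truncn (1 - t)^-1)%N.
Proof.
move=> st t1; apply: le_truncn; rewrite lef_pV2 ?posrE; last 2 first.
- by rewrite subr_gt0 (le_lt_trans st).
- by rewrite subr_gt0.
by rewrite lerB.
Qed.

Lemma slow_weight_homo T s t : s <= t -> t < 1 ->
  slow_weight T s <= slow_weight T t.
Proof.
move=> st t1; rewrite /slow_weight lerD2l.
rewrite [leRHS](big_cat_nat (n := Num.truncn (1 - s)^-1))//=; last first.
  exact: le_truncn_inv_dist1.
apply: ler_wpDr; first exact: sumr_ge0.
apply: ler_sum => n _; rewrite ler_nat.
by case: (leP (T n) s) => // Tns; rewrite (le_trans Tns st).
Qed.

(** For given m, every s close to 1 has passed the first m thresholds and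
    satisfies m <= 1/(1-s), so it counts at least m of them. *)
Lemma slow_weight_cvgy T : (forall n, T n < 1) ->
  slow_weight T s @[s --> 1^'-] --> +oo.
Proof.
move=> T1; apply/cvgryPge => A.
pose m := (Num.truncn `|A|).+1.
have Am : A <= m%:R.
  by apply: le_trans (ler_norm _) _; rewrite ltW// truncnS_gt.
near=> s.
have s1 : s < 1 by near: s; exact: nbhs_left_lt.
have Ts : forall i : 'I_m, T i <= s.
  near: s; apply: filter_forall => i; exact: nbhs_left_ge.
have ms : (m <= Num.truncn (1 - s)^-1)%N.
  rewrite truncn_ge_nat ?invr_ge0 ?subr_ge0 ?(ltW s1)//.
  rewrite -[leLHS]invrK lef_pV2 ?posrE ?invr_gt0 ?subr_gt0//.
  rewrite lerBlDl -lerBlDr; near: s; apply: nbhs_left_ge.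
  by rewrite ltrBlDr ltrDl invr_gt0.
apply: le_trans Am _; apply: (@le_trans _ _ (\sum_(0 <= n < m) (T n <= s)%R%:R)).
  rewrite big_mkord (eq_bigr (fun=> 1)) => [|i _]; last by rewrite Ts.
  by rewrite sumr_const card_ord.
rewrite /slow_weight (big_cat_nat (n := m) (p := Num.truncn _))//= addrCA lerDl.
by rewrite addr_ge0// sumr_ge0.
Unshelve. all: by end_near. Qed.

(** On [a, b] the weight is dominated by a sum of fixed length, which can be
    integrated term by term; the first m thresholds are counted whether
    they have been passed or not, because they are handled by the
    smallness of the tail of g at a alone. *)
Lemma slow_weight_le T m s b : s <= b -> b < 1 ->
  slow_weight T s <=
  m.+1%:R + \sum_(m <= n < Num.truncn (1 - b)^-1) (T n <= s)%R%:R.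
Proof.
move=> sb b1; have Nsb := le_truncn_inv_dist1 sb b1.
set N := Num.truncn (1 - b)^-1 in Nsb *.
have sum_le p q : \sum_(p <= n < q) (T n <= s)%R%:R <= (q - p)%:R :> R.
  rewrite -(sumr_const_nat q p 1).
  by apply: ler_sum => n _; rewrite lern1 leq_b1.
rewrite /slow_weight -natr1 [m%:R + 1]addrC -addrA lerD2l.
apply: (@le_trans _ _ (\sum_(0 <= n < N) (T n <= s)%R%:R)).
  rewrite [leRHS](big_cat_nat (n := Num.truncn (1 - s)^-1))//=.
  by apply: ler_wpDr => //; exact: sumr_ge0.
have [mN|/ltnW Nm] := leqP m N.
  rewrite (big_cat_nat (n := m))//= lerD2r.
  by apply: le_trans (sum_le _ _) _; rewrite subn0.
rewrite [in leRHS]big_geq// addr0; apply: le_trans (sum_le _ _) _.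
by rewrite subn0 ler_nat.
Qed.

End slow_weight.

(** * The weighted integral *)

Section Rintegral_sum.
Context d (T : measurableType d) (R : realType).
Variable mu : {measure set T -> \bar R}.

Lemma integrable_sum_EFin (I : Type) (D : set T) (r : seq I) (F : I -> T -> R) :
  measurable D -> (forall i, mu.-integrable D (EFin \o F i)) ->
  mu.-integrable D (EFin \o (fun x => \sum_(i <- r) F i x)).
Proof.
move=> mD intF.
rewrite (_ : _ \o _ = (fun x => \sum_(i <- r) (F i x)%:E)%E).
  exact: (@integrable_sum _ _ _ _ _ mD _ r _ (fun i => EFin \o F i)).
by apply/funext => x /=; rewrite sumEFin.
Qed.

Lemma Rintegral_sum (I : Type) (D : set T) (r : seq I) (F : I -> T -> R) :
  measurable D -> (forall i, mu.-integrable D (EFin \o F i)) ->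
  \int[mu]_(x in D) (\sum_(i <- r) F i x) =
  \sum_(i <- r) \int[mu]_(x in D) F i x.
Proof.
move=> mD intF; elim: r => [|i r IH].
  under eq_Rintegral do rewrite big_nil.
  by rewrite Rintegral_cst// mul0r big_nil.
under eq_Rintegral do rewrite big_cons.
by rewrite RintegralD// ?IH ?big_cons//; exact: integrable_sum_EFin.
Qed.

End Rintegral_sum.

Section weighted_integrals.
Context {R : realType}.
Implicit Types (g h : R -> R) (T : nat -> R) (a b e s t x y M : R) (m n : nat).

Lemma lebesgue_measurable_slow_weight T D : is_interval D ->
  D `<=` [set s | s < 1] -> lebesgue_measurable_fun D (slow_weight T).
Proof.
move=> iD D1; apply: lebesgue_measurable_monotone => // x y _.
by rewrite inE => /D1 y1 xy; exact: slow_weight_homo.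
Qed.

Lemma lebesgue_integrableMl (i : interval R) (u g : R -> R) M :
  lebesgue_measurable_fun [set` i] u -> (forall x, x \in i -> `|u x| <= M) ->
  lebesgue_integrable [set` i] g ->
  lebesgue_integrable [set` i] (fun s => u s * g s).
Proof.
move=> mu_ uM intg.
apply: (@integrableMr _ (lebesgueType R) _ _ _ _ u (EFin \o g)) => //.
  exact: lebesgue_measurable_itv.
exists M; split; first exact: num_real.
by move=> z /ltW Mz x /= /uM /le_trans; apply.
Qed.

Lemma lebesgue_integrable_slow_weightM T g a b : b < 1 ->
  lebesgue_integrable `[a, b] g ->
  lebesgue_integrable `[a, b] (fun s => slow_weight T s * g s).
Proof.
move=> b1; apply: (@lebesgue_integrableMl _ _ _ (slow_weight T b)).
  apply: lebesgue_measurable_slow_weight; first exact: interval_is_interval.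
  by move=> x /=; rewrite in_itv/= => /andP[_ /le_lt_trans]; apply.
move=> x; rewrite in_itv/= => /andP[_ xb].
by rewrite gtr0_norm ?slow_weight_gt0// slow_weight_homo.
Qed.

Lemma lebesgue_integrable_threshM c g a b :
  lebesgue_integrable `[a, b] g ->
  lebesgue_integrable `[a, b] (fun s => (c <= s)%R%:R * g s).
Proof.
apply: (@lebesgue_integrableMl _ _ _ 1).
  apply: lebesgue_measurable_monotone; first exact: interval_is_interval.
  move=> x y _ _ xy; rewrite ler_nat.
  by case: (leP c x) => // cx; rewrite (le_trans cx xy).
by move=> x _; rewrite ger0_norm// lern1 leq_b1.
Qed.

Lemma subset_itvcc_oo a b : 0 < a -> b < 1 ->
  [set` `[a, b]] `<=` [set` `]0, 1[].
Proof.
move=> a0 b1 x /=; rewrite !in_itv/= => /andP[ax xb].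
by rewrite (lt_le_trans a0 ax) (le_lt_trans xb b1).
Qed.

Lemma lebesgue_integrable_cc a b g : 0 < a -> b < 1 ->
  lebesgue_integrable `]0, 1[ g -> lebesgue_integrable `[a, b] g.
Proof.
move=> a0 b1; apply: lebesgue_integrableS; first exact: subset_itvcc_oo.
exact: lebesgue_measurable_itv.
Qed.

Lemma lebesgue_Rintegral_tail a b g : 0 < a -> a <= b -> b < 1 ->
  lebesgue_integrable `]0, 1[ g ->
  lebesgue_Rintegral `]a, 1[ g =
  lebesgue_Rintegral `[a, b] g + lebesgue_Rintegral `]b, 1[ g.
Proof.
move=> a0 ab b1 intg.
rewrite (@lebesgue_Rintegral_cat _ _ (BRight b) _ g); last 3 first.
- by rewrite bnd_simp.
- by rewrite bnd_simp.
- apply: lebesgue_integrableS intg; last exact: lebesgue_measurable_itv.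
  by apply: subset_itv; rewrite bnd_simp// ltW.
by rewrite lebesgue_Rintegral_oc_cc//; exact: lebesgue_integrable_cc.
Qed.

Lemma lebesgue_Rintegral_le_tail a b g : 0 < a -> a <= b -> b < 1 ->
  (forall t, t \in `]0, 1[ -> 0 <= g t) -> lebesgue_integrable `]0, 1[ g ->
  lebesgue_Rintegral `[a, b] g <= lebesgue_Rintegral `]a, 1[ g.
Proof.
move=> a0 ab b1 g0 intg; rewrite (lebesgue_Rintegral_tail a0 ab b1 intg) lerDl.
apply: Rintegral_ge0 => x /=; rewrite in_itv/= => /andP[bx x1].
by apply: g0; rewrite in_itv/= x1 andbT (lt_trans a0)// (le_lt_trans ab).
Qed.

(** The factor [c <= s] replaces [a, b] by [max(a, c), b], and the tail bound is
    available from max(a, c) on; it is then weakened since 1 - c <= 1 - a if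
    a <= c. *)
Lemma lebesgue_Rintegral_thresh_le c a b g k : 0 < a -> a <= b -> b < 1 ->
  0 <= k -> (forall t, t \in `]0, 1[ -> 0 <= g t) ->
  lebesgue_integrable `]0, 1[ g ->
  (forall t, c <= t < 1 -> lebesgue_Rintegral `]t, 1[ g <= k * (1 - t)) ->
  lebesgue_Rintegral `[a, b] (fun s => (c <= s)%R%:R * g s) <= k * (1 - a).
Proof.
move=> a0 ab b1 k0 g0 intg gk.
have intab := lebesgue_integrable_cc a0 b1 intg.
have [ca|ac] := leP c a.
  rewrite (_ : lebesgue_Rintegral _ _ = lebesgue_Rintegral `[a, b] g).
    apply: le_trans (lebesgue_Rintegral_le_tail a0 ab b1 g0 intg) _.
    by apply: gk; rewrite ca (le_lt_trans ab).
  apply: eq_Rintegral => x; rewrite inE/= in_itv/= => /andP[ax _].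
  by rewrite (le_trans ca ax) mul1r.
have [cb|bc] := leP c b; last first.
  rewrite (_ : lebesgue_Rintegral _ _ = 0).
    by rewrite mulr_ge0// subr_ge0 ltW// (le_lt_trans ab).
  rewrite /lebesgue_Rintegral (@eq_Rintegral _ _ _ _ _ (fun=> 0)).
    by rewrite Rintegral_cst ?mul0r//; exact: lebesgue_measurable_itv.
  move=> x; rewrite inE/= in_itv/= => /andP[_ xb].
  by rewrite leNgt (le_lt_trans xb bc) mul0r.
have c0 : 0 < c by exact: lt_trans ac.
rewrite (@lebesgue_Rintegral_cat _ _ (BLeft c)); last 3 first.
- by rewrite bnd_simp ltW.
- by rewrite bnd_simp.
- exact: lebesgue_integrable_threshM.
rewrite [X in X + _](_ : _ = 0); last first.
  rewrite /lebesgue_Rintegral (@eq_Rintegral _ _ _ _ _ (fun=> 0)).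
    by rewrite Rintegral_cst ?mul0r//; exact: lebesgue_measurable_itv.
  move=> x; rewrite inE/= in_itv/= => /andP[_ xc].
  by rewrite leNgt xc mul0r.
rewrite add0r [X in X <= _](_ : _ = lebesgue_Rintegral `[c, b] g).
  apply: le_trans (lebesgue_Rintegral_le_tail c0 cb b1 g0 intg) _.
  apply: (@le_trans _ _ (k * (1 - c))).
    by apply: gk; rewrite lexx (le_lt_trans cb).
  by rewrite ler_wpM2l// lerB// ltW.
apply: eq_Rintegral => x; rewrite inE/= in_itv/= => /andP[cx _].
by rewrite cx mul1r.
Qed.

(** The key estimate: it is uniform in b < 1, and for a near 1 it is made small
    relative to 1 - a by choosing first m large and then eta small. *)
Lemma lebesgue_Rintegral_slow_weight_le T g a b eta m :
  0 < a -> a <= b -> b < 1 ->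
  (forall t, t \in `]0, 1[ -> 0 <= g t) -> lebesgue_integrable `]0, 1[ g ->
  (forall n t, T n <= t < 1 -> lebesgue_Rintegral `]t, 1[ g <=
    (n.+1%:R^-1 - n.+2%:R^-1) * (1 - t)) ->
  lebesgue_Rintegral `]a, 1[ g <= eta * (1 - a) ->
  lebesgue_Rintegral `[a, b] (fun s => slow_weight T s * g s) <=
  (m.+1%:R * eta + m.+1%:R^-1) * (1 - a).
Proof.
move=> a0 ab b1 g0 intg gT geta.
have intab := lebesgue_integrable_cc a0 b1 intg.
have mD := @lebesgue_measurable_itv R `[a, b].
set N := Num.truncn (1 - b)^-1.
have a1 : 0 <= 1 - a by rewrite subr_ge0 ltW// (le_lt_trans ab).
have int1 : lebesgue_integrable `[a, b] (fun s => m.+1%:R * g s).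
  apply: (@lebesgue_integrableMl _ _ _ m.+1%:R) => //.
    exact: measurable_cst.
  by move=> x _; rewrite ger0_norm.
pose F n s := (T n <= s)%R%:R * g s.
have intF n : lebesgue_integrable `[a, b] (F n).
  exact: lebesgue_integrable_threshM.
have int2 : lebesgue_integrable `[a, b] (fun s => \sum_(m <= n < N) F n s).
  exact: integrable_sum_EFin.
apply: (@le_trans _ _ (lebesgue_Rintegral `[a, b]
    (fun s => m.+1%:R * g s + \sum_(m <= n < N) F n s))).
  apply: le_Rintegral => //.
  - exact: lebesgue_integrable_slow_weightM.
  - exact: (integrableD mD int1 int2).
  move=> x xab; have gx0 : 0 <= g x by apply: g0; exact: subset_itvcc_oo xab.
  rewrite -mulr_suml -mulrDl ler_wpM2r//; apply: slow_weight_le => //.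
  by move: xab; rewrite /= in_itv/= => /andP[].
rewrite /lebesgue_Rintegral RintegralD// RintegralZl// Rintegral_sum//.
rewrite mulrDl lerD//.
  rewrite -mulrA ler_wpM2l//; apply: le_trans geta.
  exact: lebesgue_Rintegral_le_tail.
apply: (@le_trans _ _
    (\sum_(m <= n < N) (n.+1%:R^-1 - n.+2%:R^-1) * (1 - a))).
  apply: ler_sum => n _; apply: lebesgue_Rintegral_thresh_le => //.
    by rewrite subr_ge0 lef_pV2 ?posrE// ler_nat.
  exact: gT.
rewrite -mulr_suml ler_wpM2r//.
have [mN|/ltnW Nm] := leqP m N; last by rewrite big_geq.
(* the signs turn the decreasing differences into the form that telescopes *)
rewrite (eq_bigr (fun n => - n.+2%:R^-1 - - n.+1%:R^-1)); last first.
  by move=> n _; rewrite opprK addrC.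
by rewrite (telescope_sumr (fun n => - n.+1%:R^-1))// opprK addrC gerDl oppr_le0.
Qed.

End weighted_integrals.

(** * Limits at 1 *)

Section limits.
Context {R : realType}.
Implicit Types (P : R -> Prop) (u v : R -> R) (e t M : R).

Lemma bounded_itv_norm_le (i : interval R) u :
  [bounded u t | t in [set` i]] -> exists M, forall t, t \in i -> `|u t| <= M.
Proof.
move=> [M [_ uM]]; exists (M + 1) => t ti.
by apply: (uM (M + 1)) => //; rewrite ltrDl.
Qed.

Lemma near_at_left1 P : (\forall t \near 1^'-, P t) ->
  exists2 a, a \in `]0, 1[ & forall t, a <= t < 1 -> P t.
Proof.
rewrite near_withinE => /nbhs_ballP[e /= e0 eP].
pose a := 1 - Num.min (e / 2) 2^-1.
have m0 : 0 < Num.min (e / 2) 2^-1 by rewrite lt_min divr_gt0//= invr_gt0.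
have me : Num.min (e / 2) 2^-1 <= e / 2 by rewrite ge_min lexx.
have m2 : Num.min (e / 2) 2^-1 <= 2^-1 by rewrite ge_min lexx orbT.
exists a; first by rewrite in_itv/= /a; apply/andP; split; lra.
move=> t /andP[at_ t1]; apply: eP => //=.
by rewrite /ball/= gtr0_norm ?subr_gt0//; rewrite /a in at_; lra.
Qed.

Lemma cvg0_average_le u e : (1 - t)^-1 * u t @[t --> 1^'-] --> (0 : R) ->
  0 < e -> \forall t \near 1^'-, `|u t| <= e * (1 - t).
Proof.
move=> /cvgrPdist_le/(_ e) + e0 => /(_ e0) u_le; near=> t.
have t1 : 0 < 1 - t by rewrite subr_gt0; near: t; exact: nbhs_left_lt.
have : `|0 - (1 - t)^-1 * u t| <= e by near: t.
by rewrite sub0r normrN normrM gtr0_norm ?invr_gt0// mulrC ler_pdivrMr.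
Unshelve. all: by end_near. Qed.

Lemma limn_esup_le (U : nat -> \bar R) (V : nat -> R) l :
  (forall k, (U k <= (V k)%:E)%E) -> V @ \oo --> l ->
  (limn_esup U <= l%:E)%E.
Proof.
move=> UV /cvgrPdist_le Vl; apply/lee_addgt0Pr => e e0.
rewrite limn_esup_lim; apply: lime_le; first exact: is_cvg_esups.
have [N _ NV] := Vl _ e0; exists N => // n /= Nn.
apply: ge_ereal_sup => _ [k /= nk <-]; apply: le_trans (UV k) _.
rewrite -EFinD lee_fin -lerBlDl.
have := NV k (leq_trans Nn nk); rewrite /= distrC.
by apply: le_trans; exact: ler_norm.
Qed.

End limits.

(** * Forward averages of the weighted function *)

Section forward_averages.
Context {R : realType}.

Lemma exists_slow_weight_times (g : R -> R) :
  (1 - t)^-1 * lebesgue_Rintegral `]t, 1[ g @[t --> 1^'-] --> 0 ->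
  exists T : nat -> R, (forall n, T n < 1) /\
    forall n t, T n <= t < 1 ->
      lebesgue_Rintegral `]t, 1[ g <= (n.+1%:R^-1 - n.+2%:R^-1) * (1 - t).
Proof.
move=> g_lim.
have /choice[T TP] : forall n : nat, exists a, a < 1 /\ forall t, a <= t < 1 ->
    lebesgue_Rintegral `]t, 1[ g <= (n.+1%:R^-1 - n.+2%:R^-1) * (1 - t).
  move=> n; have d0 : 0 < n.+1%:R^-1 - n.+2%:R^-1 :> R.
    by rewrite subr_gt0 ltf_pV2 ?posrE// ltr_nat.
  have [a] := near_at_left1 (cvg0_average_le g_lim d0).
  rewrite in_itv/= => /andP[_ a1] aP; exists a; split=> // t /aP.
  by apply: le_trans; exact: ler_norm.
by exists T; split=> [n|n t]; [case: (TP n)|case: (TP n) => _; apply].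
Qed.

(** With m > 8/e - 1 and eta = e / (8 (m+1)), the weighted part of the integral
    over [a, b] is at most (e/4)(1 - a).  The part of h is the difference of
    two tails, each at most (e/8)(1 - a) in absolute value.  The sum is
    (e/2)(1 - a) = e (c - a) for the midpoint c, as
    [exists_forward_average_le] requires. *)
Lemma exists_forward_average_weight_le (g h : R -> R) (T : nat -> R) (e : R) :
  lebesgue_measurable_fun `]0, 1[ g -> lebesgue_measurable_fun `]0, 1[ h ->
  [bounded g t | t in `]0, 1[%classic] ->
  [bounded h t | t in `]0, 1[%classic] ->
  (forall t, t \in `]0, 1[ -> 0 <= g t) ->
  (forall n t, T n <= t < 1 ->
    lebesgue_Rintegral `]t, 1[ g <= (n.+1%:R^-1 - n.+2%:R^-1) * (1 - t)) ->
  (1 - t)^-1 * lebesgue_Rintegral `]t, 1[ g @[t --> 1^'-] --> 0 ->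
  (1 - t)^-1 * lebesgue_Rintegral `]t, 1[ h @[t --> 1^'-] --> 0 ->
  0 < e ->
  exists t, [/\ t \in `]0, 1[, 1 - e <= t & forall tau, tau \in `]0, 1 - t[ ->
    lebesgue_Rintegral `[t, t + tau] (fun s => slow_weight T s * g s + h s)
      <= e * tau].
Proof.
move=> mg mh /bounded_itv_norm_le[Mg gM] /bounded_itv_norm_le[Mh hM].
move=> g0 gT g_lim h_lim e0.
have fin01 := @lebesgue_measure_itv_lty R false true 0 1.
have intg : lebesgue_integrable `]0, 1[ g.
  exact: lebesgue_bounded_integrable gM.
have inth : lebesgue_integrable `]0, 1[ h.
  exact: lebesgue_bounded_integrable hM.
pose m := Num.truncn (8 / e).
have me : m.+1%:R^-1 <= e / 8.
  rewrite -[leRHS]invrK lef_pV2 ?posrE ?invr_gt0 ?divr_gt0// invf_div.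
  by rewrite ltW// truncnS_gt.
pose eta := e / 8 / m.+1%:R.
have eta0 : 0 < eta by rewrite !divr_gt0.
have e8 : 0 < e / 8 by rewrite divr_gt0.
have ne : \forall t \near 1^'-, 1 - e <= t.
  by apply: nbhs_left_ge; rewrite ltrBlDr ltrDl.
have [a a01 aP] := near_at_left1 (filterI ne
  (filterI (cvg0_average_le g_lim eta0) (cvg0_average_le h_lim e8))).
move: (a01); rewrite in_itv/= => /andP[a0 a1].
pose f s := slow_weight T s * g s + h s.
have intwg b : b < 1 ->
    lebesgue_integrable `[a, b] (fun s => slow_weight T s * g s).
  move=> b1; apply: lebesgue_integrable_slow_weightM => //.
  exact: lebesgue_integrable_cc.
have intf b : b < 1 -> lebesgue_integrable `[a, b] f.
  move=> b1; have mD := @lebesgue_measurable_itv R `[a, b].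
  exact: (integrableD mD (intwg b b1) (lebesgue_integrable_cc a0 b1 inth)).
pose c := (a + 1) / 2.
have ac : a < c by rewrite /c; lra.
have c1 : c < 1 by rewrite /c; lra.
have fM s : s \in `[a, c] -> `|f s| <= slow_weight T c * Mg + Mh.
  move=> sac; have s01 : s \in `]0, 1[ by exact: (subset_itvcc_oo a0 c1 sac).
  move: sac; rewrite in_itv/= => /andP[_ sc].
  apply: le_trans (ler_normD _ _) _; rewrite lerD ?hM// normrM.
  rewrite gtr0_norm ?slow_weight_gt0// ler_pM ?gM//.
    exact/ltW/slow_weight_gt0.
  exact: slow_weight_homo.
have fc b : b \in `]c, 1[ -> lebesgue_Rintegral `[a, b] f <= e * (c - a).
  rewrite in_itv/= => /andP[cb b1].
  have ab : a <= b by rewrite ltW// (lt_trans ac).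
  have [_ [ga ha]] : [set t | 1 - e <= t] a /\
      `|lebesgue_Rintegral `]a, 1[ g| <= eta * (1 - a) /\
      `|lebesgue_Rintegral `]a, 1[ h| <= e / 8 * (1 - a).
    by apply: aP; rewrite lexx.
  have [_ [_ hb]] := aP b (introT andP (conj ab b1)).
  have wg := lebesgue_Rintegral_slow_weight_le m a0 ab b1 g0 intg gT
    (le_trans (ler_norm _) ga).
  have hab := lebesgue_Rintegral_tail a0 ab b1 inth.
  have etam : m.+1%:R * eta = e / 8 by rewrite /eta mulrC divfK.
  have wg' : lebesgue_Rintegral `[a, b] (fun s => slow_weight T s * g s) <=
      (e / 8 + e / 8) * (1 - a).
    by apply: le_trans wg _; rewrite etam ler_wpM2r ?subr_ge0 ?(ltW a1)// lerD2l.
  rewrite /lebesgue_Rintegral RintegralD; first last.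
  - exact: lebesgue_integrable_cc.
  - exact: intwg.
  - exact: lebesgue_measurable_itv.
  have hba : e / 8 * (1 - b) <= e / 8 * (1 - a).
    by rewrite ler_wpM2l ?(ltW e8)// lerB.
  move: ha hb hab wg'; rewrite !ler_norml /lebesgue_Rintegral /c.
  by move=> /andP[_ ha] /andP[hb _]; lra.
have [t tac tP] := exists_forward_average_le ac c1 (ltW e0) intf fM fc.
exists t; split=> //.
- exact: (subset_itvcc_oo a0 c1 tac).
- move: tac; rewrite in_itv/= => /andP[at_ tc].
  by have [] := aP t; first by rewrite at_ (le_lt_trans tc).
Qed.

End forward_averages.

Theorem lemma4p1 (R : realType) (g h : R -> R)
    (mg : lebesgue_measurable_fun `]0, 1[ g)
    (mh : lebesgue_measurable_fun `]0, 1[ h)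
    (bg : [bounded g t | t in `]0, 1[%classic])
    (bh : [bounded h t | t in `]0, 1[%classic])
    (g_ge0 : forall t : R, t \in `]0, 1[ -> 0 <= g t)
    (g_lim : (1 - t)^-1 * lebesgue_Rintegral `]t, 1[ g @[t --> 1^'-] --> 0)
    (h_lim : (1 - t)^-1 * lebesgue_Rintegral `]t, 1[ h @[t --> 1^'-] --> 0) :
  exists (lambda : R -> R) (tk : nat -> R),
    [/\ forall t : R, t \in `]0, 1[ -> 0 < lambda t,
        {in `]0, 1[ &, {homo lambda : x y / x <= y}} &
        lambda t @[t --> 1^'-] --> +oo] /\
    [/\ forall k, tk k \in `]0, 1[,
        tk @ \oo --> (1 : R) &
        (limn_esup (fun k => ereal_sup
           [set (tau^-1 * lebesgue_Rintegral `[tk k, tk k + tau]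
                   (fun s => lambda s * g s + h s))%R%:E
           | tau in `]0%R, (1 - tk k)%R[%classic]) <= 0)%E].
Proof.
have [T [T1 gT]] := exists_slow_weight_times g_lim.
have /choice[tk tkP] k := exists_forward_average_weight_le mg mh bg bh g_ge0 gT
  g_lim h_lim (harmonic_gt0 k).
exists (slow_weight T), tk; split; split.
- by move=> t _; exact: slow_weight_gt0.
- move=> x y _; rewrite in_itv/= => /andP[_ y1] xy.
  exact: slow_weight_homo.
- exact: slow_weight_cvgy.
- by move=> k; have [] := tkP k.
- apply: (@squeeze_cvgr _ _ _ _ (fun k => 1 - harmonic k) (fun=> 1)).
  + apply: nearW => k; have [+ -> _] := tkP k.
    by rewrite in_itv/= => /andP[_ /ltW].
  + rewrite -[X in _ --> X]subr0; apply: cvgB; last exact: cvg_harmonic.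
    exact: cvg_cst.
  + exact: cvg_cst.
- apply: limn_esup_le (@cvg_harmonic R) => k.
  apply: ge_ereal_sup => _ [tau /= tau01 <-]; rewrite lee_fin.
  have [_ _ /(_ tau tau01)] := tkP k.
  move: tau01; rewrite in_itv/= => /andP[tau0 _].
  by rewrite ler_pdivrMl// [tau * _]mulrC.
Qed.
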